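(* Let $G=(V,E)$ be a connected $d$-regular graph and let $k\in\mathbb{R}$ be such that $\kappa(v_1,v_2)\geq k$ for every pair of distinct vertices $v_1,v_2\in V$. Fix $x\in V$ and for $i\ge 0$ let $S_i=\{v\in V:\mathrm{dist}(x,v)=i\}$. Then for every $i\geq 1$, $$|S_{i+1}|\leq \frac{d+1-2dk}{2}\,|S_i|.$$
   Context: $\mathrm{dist}$ is the graph distance. For a vertex $x$ of degree $d_x$, $\mu_x$ is the probability measure on $V$ with $\mu_x(x)=\tfrac12$, $\mu_x(v)=\tfrac{1}{2d_x}$ if $v\sim x$, and $\mu_x(v)=0$ otherwise. For probability measures $\mu,\nu$ of finite support, $W_1(\mu,\nu)=\inf_m\sum_{u,v}\mathrm{dist}(u,v)\,m(u,v)$, the infimum over couplings $m$ of $\mu$ and $\nu$. The Ollivier curvature of distinct vertices $x,y$ is $\kappa(x,y)=1-\frac{W_1(\mu_x,\mu_y)}{\mathrm{dist}(x,y)}$. *)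

(* Defs.v *)
From HB Require Import structures.
From mathcomp Require Import all_boot all_order all_algebra finmap.
From mathcomp Require Import all_classical reals ereal esum.

Set Implicit Arguments.
Unset Strict Implicit.
Unset Printing Implicit Defensive.

Import Order.TTheory GRing.Theory Num.Theory.
Local Open Scope classical_set_scope.
Local Open Scope ring_scope.

(* A simple graph, finite or infinite, on the vertex type V is a symmetric and
   irreflexive relation e : rel V. *)

Section Graph.
Variables (V : choiceType) (e : rel V).

Definition simple_graph : Prop := symmetric e /\ irreflexive e.

Definition connected_graph : Prop :=
  forall x y : V, exists p : seq V, path e x p /\ last x p = y.

Definition nbrs (x : V) : set V := [set v | e x v].

Definition deg (x : V) : nat := #|` fset_set (nbrs x)|.

(* Finiteness is required separately because fset_set sends infinite sets to
   the empty one. *)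
Definition regular_graph (d : nat) : Prop :=
  forall x : V, finite_set (nbrs x) /\ deg x = d.

Definition has_walk (x y : V) (n : nat) : Prop :=
  exists p : seq V, [/\ path e x p, last x p = y & size p = n].

(* The least length of a walk from x to y. The default value 0 is only taken
   when no walk exists, hence never in a connected graph. *)
Definition gdist (x y : V) : nat :=
  if pselect (exists n, `[< has_walk x y n >]) is left h then ex_minn h else 0%N.

Definition sphere (x : V) (i : nat) : set V := [set v | gdist x v = i].

Lemma has_walk_gdist (x y : V) : connected_graph -> has_walk x y (gdist x y).
Proof.
move=> con; rewrite /gdist; case: pselect => [h|[]].
  by case: ex_minnP => n /asboolP.
by have [p [ep lp]] := con x y; exists (size p); apply/asboolP; exists p.
Qed.

Lemma gdist_le_walk (x y : V) (n : nat) : has_walk x y n -> (gdist x y <= n)%N.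
Proof.
move=> w; rewrite /gdist; case: pselect => // h.
by case: ex_minnP => m _; apply; apply/asboolP.
Qed.

(* Hence #|` fset_set (sphere x i)| is the actual cardinality of the sphere. *)
Lemma sphere_finite (d : nat) (x : V) (i : nat) :
  connected_graph -> regular_graph d -> finite_set (sphere x i).
Proof.
move=> con reg; apply: (@sub_finite_set _ _ [set v | has_walk x v i]).
  by move=> v /= <-; exact: has_walk_gdist.
elim: i => [|i IH].
  apply: (@sub_finite_set _ _ [set x]) => // v [p []].
  by case: p => //= _ <-.
apply: (@sub_finite_set _ _ (\bigcup_(u in [set u | has_walk x u i]) nbrs u)).
  move=> v [p]; case/lastP: p => [[]//|p u].
  rewrite rcons_path last_rcons size_rcons => -[/andP[pp eu] <- [sp]].
  by exists (last x p) => //; exists p.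
by apply: bigcup_finite => // u _; exact: (reg u).1.
Qed.

End Graph.

Section Curvature.
Variables (R : realType) (V : choiceType) (e : rel V).

Definition lazy_walk (x v : V) : R :=
  if v == x then 2^-1
  else if e x v then (2 * (deg e x)%:R)^-1
  else 0.

Definition coupling (mu nu : V -> R) (m : V * V -> R) : Prop :=
  [/\ forall p, 0 <= m p,
      forall u, (\esum_(v in [set: V]) (m (u, v))%:E = (mu u)%:E)%E &
      forall v, (\esum_(u in [set: V]) (m (u, v))%:E = (nu v)%:E)%E].

Definition transport_cost (m : V * V -> R) : \bar R :=
  (\esum_(p in [set: V * V]) ((gdist e p.1 p.2)%:R * m p)%:E)%E.

Definition W1 (mu nu : V -> R) : \bar R :=
  ereal_inf [set transport_cost m | m in coupling mu nu].

(* The value is finite whenever x <> y lie in a connected locally finite graph: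
   W1 is then an infimum of nonnegative costs, and the product coupling of the
   two finitely supported measures has finite cost. *)
Definition ollivier (x y : V) : \bar R :=
  (1 - W1 (lazy_walk x) (lazy_walk y) * ((gdist e x y)%:R^-1)%:E)%E.

End Curvature.

(* Main.v *)
Require Import Defs.
From HB Require Import structures.
From mathcomp Require Import all_boot all_order all_algebra finmap.
From mathcomp Require Import all_classical reals ereal esum.
From mathcomp Require Import lra zify.

Set Implicit Arguments.
Unset Strict Implicit.
Unset Printing Implicit Defensive.

Import Order.TTheory GRing.Theory Num.Theory.
Local Open Scope classical_set_scope.
Local Open Scope ring_scope.

(* Let y be in S_i and z a neighbour of y in S_{i-1}. Let a be the number of
   children of y (neighbours in S_{i+1}), and b the number of those whose only
   parent is y. A 1-Lipschitz function that is 2 on the latter, 1 on y and its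
   other children, and 0 at z and at all neighbours of z except y gives
   1/2 + (a+b)/(2d) - 1/(2d) <= W_1(mu_z, mu_y) <= 1 - k, that is
   a + b <= d + 1 - 2dk. Summing over y in S_i, a vertex w of S_{i+1} with p
   parents contributes p + [p = 1] >= 2 to the left-hand side. *)

(** * Graph distance along edges *)

Section GraphDistance.
Variables (V : choiceType) (e : rel V).
Hypothesis hconn : connected_graph e.

(** Along a shortest walk [f] gains at most one per edge, so the Lipschitz condition need only be
    checked on edges. *)
Lemma lipschitz_edge_gdist (f : V -> nat) :
  (forall u v, e u v -> (f v <= (f u).+1)%N) ->
  forall u v, (f v <= f u + gdist e u v)%N.
Proof.
move=> fe u v; have [p [pp <- <-]] := has_walk_gdist u v hconn.
elim: p u pp => [|w p IH] u /=; first by rewrite addn0.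
move=> /andP[uw /IH le_w]; apply: leq_trans le_w _.
by rewrite addnS -addSn leq_add2r fe.
Qed.

Lemma gdist_edge (x u v : V) : e u v -> (gdist e x v <= (gdist e x u).+1)%N.
Proof.
move=> uv; have [p [pp pu ps]] := has_walk_gdist x u hconn.
apply: gdist_le_walk; exists (rcons p v).
by rewrite rcons_path pp pu uv last_rcons size_rcons ps.
Qed.

Lemma gdist_edge_eq1 (u v : V) : irreflexive e -> e u v -> gdist e u v = 1%N.
Proof.
move=> irr uv; apply/eqP; rewrite eqn_leq; apply/andP; split.
  by apply: gdist_le_walk; exists [:: v]; rewrite /= uv.
rewrite lt0n; apply/eqP => d0; have := has_walk_gdist u v hconn.
rewrite d0 => -[p [_ + /size0nil p0]]; rewrite p0 /= => uv_eq.
by rewrite uv_eq irr in uv.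
Qed.

(** The witness is the last vertex but one of a shortest walk. Only the upper bound is stated, as
    [gdist_edge] gives the lower one. *)
Lemma sphere_pred (x y : V) (i : nat) : sphere e x i.+1 y ->
  exists2 z, e z y & (gdist e x z <= i)%N.
Proof.
rewrite /sphere /= => dxy; have := has_walk_gdist x y hconn; rewrite dxy.
move=> [p []]; case/lastP: p => // p w.
rewrite rcons_path last_rcons size_rcons => /andP[pp pw] <- [ps].
by exists (last x p) => //; apply: gdist_le_walk; exists p.
Qed.

End GraphDistance.

(** * Lower bounds for transport cost *)

Section Transport.
Variables (R : realType) (V : choiceType) (e : rel V).

Lemma esum_natmul (T : choiceType) (n : nat) (a : T -> R) (s : R) :
  (forall i, 0 <= a i) -> \esum_(i in [set: T]) (a i)%:E = s%:E ->
  \esum_(i in [set: T]) (n%:R * a i)%:E = (n%:R * s)%:E.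
Proof.
move=> a0 as_; elim: n => [|n IH].
  by rewrite mul0r; apply: esum1 => i _; rewrite mul0r.
rewrite (@eq_esum _ _ _ _ (fun i => (a i)%:E + (n%:R * a i)%:E)%E); last first.
  by move=> i _; rewrite -EFinD -[n.+1]add1n natrD mulrDl mul1r.
rewrite esumD ?as_ ?IH; first by rewrite -EFinD -[n.+1]add1n natrD mulrDl mul1r.
- by move=> i _; rewrite lee_fin.
- by move=> i _; rewrite lee_fin mulr_ge0.
Qed.

Lemma esum_pair (a : V -> V -> \bar R) : (forall u v, (0 <= a u v)%E) ->
  \esum_(p in [set: V * V]) a p.1 p.2 =
  \esum_(u in [set: V]) \esum_(v in [set: V]) a u v.
Proof.
move=> a0; rewrite esum_esum//; congr (esum _ _).
by apply/seteqP; split.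
Qed.

Lemma esum_pair_swap (a : V -> V -> \bar R) : (forall u v, (0 <= a u v)%E) ->
  \esum_(p in [set: V * V]) a p.1 p.2 =
  \esum_(v in [set: V]) \esum_(u in [set: V]) a u v.
Proof.
move=> a0; rewrite -(@esum_pair (fun v u => a u v))//.
rewrite (@reindex_esum _ _ _ setT setT (fun p => (p.2, p.1)))//=.
split => //; first by move=> [? ?] [? ?] _ _ /= [-> ->].
by move=> [u v] _; exists (v, u).
Qed.

(* The easy half of Kantorovich duality. *)
Lemma coupling_lipschitz_le (mu nu : V -> R) (m : V * V -> R) (f : V -> nat) :
  coupling mu nu m -> (forall u v, (f v <= f u + gdist e u v)%N) ->
  (\esum_(v in [set: V]) ((f v)%:R * nu v)%:E <=
   \esum_(u in [set: V]) ((f u)%:R * mu u)%:E + transport_cost e m)%E.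
Proof.
move=> [m0 mmu mnu] flip.
(* Through its marginals, [m] turns both sums into sums over pairs, where the inequality holds term
   by term. *)
have -> : \esum_(v in [set: V]) ((f v)%:R * nu v)%:E =
    \esum_(p in [set: V * V]) ((f p.2)%:R * m p)%:E.
  pose a u v := ((f v)%:R * m (u, v))%:E.
  rewrite [RHS](@eq_esum _ _ _ _ (fun p => a p.1 p.2)); last by case.
  rewrite esum_pair_swap; last by move=> u v; rewrite lee_fin mulr_ge0.
  by apply: eq_esum => v _; rewrite (esum_natmul _ _ (mnu v)).
have -> : \esum_(u in [set: V]) ((f u)%:R * mu u)%:E =
    \esum_(p in [set: V * V]) ((f p.1)%:R * m p)%:E.
  pose a u v := ((f u)%:R * m (u, v))%:E.
  rewrite [RHS](@eq_esum _ _ _ _ (fun p => a p.1 p.2)); last by case.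
  rewrite esum_pair; last by move=> u v; rewrite lee_fin mulr_ge0.
  by apply: eq_esum => u _; rewrite (esum_natmul _ _ (mmu u)).
rewrite /transport_cost -esumD; first last.
- by move=> p _; rewrite lee_fin mulr_ge0.
- by move=> p _; rewrite lee_fin mulr_ge0.
apply: le_esum => p _; rewrite -EFinD lee_fin -mulrDl -natrD.
by rewrite ler_wpM2r// ler_nat.
Qed.

(** The sum against [mu] is given as a real number so that it can be subtracted; against [nu] a
    lower bound is enough. *)
Lemma W1_lipschitz_ge (mu nu : V -> R) (f : V -> nat) (a b : R) :
  (forall u v, (f v <= f u + gdist e u v)%N) ->
  \esum_(u in [set: V]) ((f u)%:R * mu u)%:E = a%:E ->
  (b%:E <= \esum_(v in [set: V]) ((f v)%:R * nu v)%:E)%E ->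
  ((b - a)%:E <= W1 e mu nu)%E.
Proof.
move=> flip fa fb; apply: le_ereal_inf_tmp => _ [m cm <-].
rewrite EFinB leeBlDl//; apply: le_trans fb _; rewrite -fa.
exact: coupling_lipschitz_le.
Qed.

Lemma ollivier_edge_ge (k : R) (u v : V) : gdist e u v = 1%N ->
  (k%:E <= ollivier R e u v)%E ->
  (W1 e (lazy_walk R e u) (lazy_walk R e v) <= (1 - k)%:E)%E.
Proof.
rewrite /ollivier => ->; rewrite invr1 mule1.
(* An infinite [W1] would make the curvature minus infinity, against the lower bound [k]. *)
case: W1 => [w| |] //=; last by rewrite leNye.
by rewrite -EFinB !lee_fin; lra.
Qed.

End Transport.

Lemma count1_eq (T : eqType) (P : pred T) (s : seq T) (a b : T) :
  count P s = 1%N -> a \in s -> b \in s -> P a -> P b -> a = b.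
Proof.
rewrite -size_filter => s1 sa sb Pa Pb.
have : a \in [seq c <- s | P c] by rewrite mem_filter Pa.
have : b \in [seq c <- s | P c] by rewrite mem_filter Pb.
case: [seq c <- s | P c] s1 => [//|c [|//]] _.
by rewrite !mem_seq1 => /eqP-> /eqP->.
Qed.

(** * Weighted count of the edges between consecutive spheres *)

Section Children.
Variables (R : realType) (V : choiceType) (e : rel V) (d : nat) (k : R).
Hypothesis hsimple : simple_graph e.
Hypothesis hconn : connected_graph e.
Hypothesis hreg : regular_graph e d.
Hypothesis hk : forall v1 v2 : V, v1 <> v2 -> (k%:E <= ollivier R e v1 v2)%E.
Variables (x : V) (i : nat).
Hypothesis hi : (1 <= i)%N.

Let S := fset_set (sphere e x i).
Let T := fset_set (sphere e x i.+1).
Let parents (w : V) : nat := count (e^~ w) S.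
(** The value at [w], for [w] in [T], of the potential attached below to any parent of [w]. *)
Let weight (w : V) : nat := (1 + (parents w == 1))%N.

Let memS v : (v \in S) = (gdist e x v == i).
Proof.
rewrite in_fset_set; last exact: (sphere_finite x i hconn hreg).
by apply/idP/eqP; rewrite inE.
Qed.

Let memT v : (v \in T) = (gdist e x v == i.+1).
Proof.
rewrite in_fset_set; last exact: (sphere_finite x i.+1 hconn hreg).
by apply/idP/eqP; rewrite inE.
Qed.

Let sole_child y v := [&& v \in T, e y v & parents v == 1%N].

(* The truncation of the distance that is 2 on the children of [y] having [y] as
   only parent, and 1 on [y] and its other children. *)
Let potential y v : nat :=
  ([|| v == y, (v \in T) && e y v | `[< exists2 b, sole_child y b & e b v >]]
   + sole_child y v)%N.

(** Only an edge arriving at the value 2 could break the bound; the existential clause of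
    [potential] gives all neighbours of such a vertex a value of at least 1. *)
Let potential_edge y u v : e u v -> (potential y v <= (potential y u).+1)%N.
Proof.
move=> uv; rewrite /potential; case: (boolP (sole_child y v)) => [sv|_].
  suff -> : `[< exists2 b, sole_child y b & e b u >] by rewrite !orbT; lia.
  by apply/asboolP; exists v => //; rewrite hsimple.1.
by rewrite addn0; exact: leq_trans (leq_b1 _) _.
Qed.

(** Such a [v] has level at most [i], so it is no child of [y]. If it were adjacent to a sole child
    [b] of [y], it would have level [i] and be a second parent of [b]. *)
Let potential_near0 y z v : e z y -> (gdist e x z < i)%N ->
  v != y -> (v == z) || e z v -> potential y v = 0%N.
Proof.
move=> zy zi vy zv.
have vi : (gdist e x v <= i)%N.
  case/orP: zv => [/eqP->|/(gdist_edge hconn x)]; lia.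
have vT : v \in T = false by rewrite memT; apply/eqP; lia.
rewrite /potential /sole_child vT (negbTE vy) /= addn0.
case: asboolP => // -[b /and3P[bT yb /eqP pb] bv].
have bi := eqP (etrans (esym (memT b)) bT).
have vb : e v b by rewrite hsimple.1.
have le_b := gdist_edge hconn x vb.
have vS : v \in S by rewrite memS; apply/eqP; lia.
have yS : y \in S.
  rewrite memS; apply/eqP.
  have := gdist_edge hconn x yb; have := gdist_edge hconn x zy; lia.
by move: vy; rewrite (count1_eq pb vS yS vb yb) eqxx.
Qed.

Let potential_child y w : w \in T -> e y w -> (weight w <= potential y w)%N.
Proof.
move=> wT yw; rewrite /weight /potential /sole_child wT yw /= orbT.
by rewrite leq_add2l.
Qed.

Lemma sum_weight_children_le y : y \in S ->
  (\sum_(w <- T | e y w) (weight w)%:R : R) <= d%:R + 1 - 2 * d%:R * k.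
Proof.
move=> yS; have yi := eqP (etrans (esym (memS y)) yS).
(* A parent of [y] exists because [i] is at least 1. *)
have [z zy zi] : exists2 z, e z y & (gdist e x z < i)%N.
  case: i hi yi => // j _ /(sphere_pred hconn) [z zy zj].
  by exists z => //; rewrite ltnS.
have zNy : z <> y by move=> zy_; move: zy; rewrite zy_ hsimple.2.
have d0 : (0 < d)%N.
  rewrite -(hreg z).2 /deg cardfs_gt0; apply/fset0Pn; exists y.
  by rewrite in_fset_set ?inE//; exact: (hreg z).1.
have W := ollivier_edge_ge (gdist_edge_eq1 hconn hsimple.2 zy) (hk zNy).
set s := \sum_(_ <- _ | _) _.
(* On the support of the walk from [z], the potential vanishes except at [y], where it is 1. *)
have Ez : \esum_(u in [set: V]) ((potential y u)%:R * lazy_walk R e z u)%:E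
    = ((2 * d%:R)^-1)%:E.
  rewrite (@eq_esum _ _ _ _ (fun u => if u \in [set y]
      then ((potential y u)%:R * lazy_walk R e z u)%:E else 0%E)); last first.
    move=> u _; case: ifPn => //; rewrite notin_setE => /eqP uy.
    case: (boolP ((u == z) || e z u)) => [zu|/norP[uz zu]].
      by rewrite (potential_near0 zy zi uy zu) mul0r.
    by rewrite /lazy_walk (negbTE uz) (negbTE zu) mulr0.
  have Ey : potential y y = 1%N.
    by rewrite /potential /sole_child eqxx hsimple.2 andbF.
  have -> : ((2 * d%:R)^-1)%:E = ((potential y y)%:R * lazy_walk R e z y)%:E.
    rewrite Ey mul1r /lazy_walk zy (hreg z).2.
    by case: eqP => // yz; case: zNy.
  rewrite -esum_mkcond esum_set1// lee_fin mulr_ge0// /lazy_walk zy.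
  by case: ifP => _; rewrite invr_ge0 ?mulr_ge0.
(* The finite partial sum over [y] and its children already reaches this bound. *)
have Ey : ((2^-1 + s / (2 * d%:R))%:E <=
    \esum_(v in [set: V]) ((potential y v)%:R * lazy_walk R e y v)%:E)%E.
  pose A := y :: [seq w <- T | e y w].
  have uA : uniq A.
    by rewrite /A /= mem_filter hsimple.2 /= filter_uniq// fset_uniq.
  apply: esum_ge; exists [set` A]; first by split.
  rewrite -fsbig_seq// sumEFin lee_fin big_cons big_filter.
  rewrite lerD//.
    rewrite /lazy_walk eqxx /potential /sole_child eqxx hsimple.2 andbF addn0.
    by rewrite mul1r.
  rewrite /s mulr_suml big_seq_cond [leRHS]big_seq_cond.
  apply: ler_sum => w /andP[wT yw].
  rewrite /lazy_walk yw (hreg y).2.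
  have -> : (w == y) = false.
    by apply/eqP => wy; move: yw; rewrite wy hsimple.2.
  by rewrite ler_wpM2r ?invr_ge0 ?mulr_ge0// ler_nat potential_child.
have := le_trans (W1_lipschitz_ge
  (lipschitz_edge_gdist hconn (@potential_edge y)) Ez Ey) W.
have dR : 0 < d%:R :> R by rewrite ltr0n.
(* Multiplying by [2 * d] gives [d + s - 1 <= 2 * d * (1 - k)]. *)
rewrite lee_fin -(ler_pM2r (mulr_gt0 (ltr0n R 2) dR)).
have q0 : 2 * d%:R != 0 :> R by rewrite mulf_neq0 ?gt_eqF.
rewrite mulrBl mulrDl divfK// mulVf//; lra.
Qed.

(** A shortest walk supplies one parent; if there is no other, the weight is 2. *)
Lemma two_le_parents_weight w : w \in T -> (2 <= parents w * weight w)%N.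
Proof.
rewrite memT => /eqP wi; have [y yw yi] := sphere_pred hconn wi.
suff : (0 < parents w)%N by rewrite /weight; case: eqP => /=; lia.
rewrite /parents -has_count; apply/hasP; exists y => //.
by rewrite memS eqn_leq yi -ltnS -wi; exact: gdist_edge.
Qed.

(** Double counting of the edges between [S] and [T], each weighted by its end in [T]. *)
Lemma card_sphereS_le :
  (2 * #|` T|)%:R <= (d%:R + 1 - 2 * d%:R * k) * #|` S|%:R.
Proof.
have -> : (d%:R + 1 - 2 * d%:R * k) * #|` S|%:R
    = \sum_(y <- S) (d%:R + 1 - 2 * d%:R * k).
  by rewrite big_const_seq count_predT iter_addr_0 mulr_natr.
apply: (@le_trans _ _ (\sum_(y <- S) \sum_(w <- T | e y w) (weight w)%:R)).
  rewrite (exchange_big_dep predT)//=.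
  have -> : (2 * #|` T|)%:R = \sum_(w <- T) 2 :> R.
    by rewrite big_const_seq count_predT iter_addr_0 natrM mulr_natr.
  rewrite big_seq_cond [leRHS]big_seq_cond; apply: ler_sum => w /andP[wT _].
  rewrite big_const_seq iter_addr_0 -mulrnA ler_nat.
  by rewrite mulnC two_le_parents_weight.
rewrite big_seq [leRHS]big_seq; apply: ler_sum => y.
exact: sum_weight_children_le.
Qed.

End Children.

Theorem theorem4p4 (R : realType) (V : choiceType) (e : rel V) (d : nat) (k : R)
    (hsimple : simple_graph e) (hconn : connected_graph e)
    (hreg : regular_graph e d)
    (hk : forall v1 v2 : V, v1 <> v2 -> (k%:E <= ollivier R e v1 v2)%E)
    (x : V) (i : nat) (hi : (1 <= i)%N) :
  (#|` fset_set (sphere e x i.+1)|%:R : R)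
    <= (d%:R + 1 - 2 * d%:R * k) / 2 * #|` fset_set (sphere e x i)|%:R.
Proof.
have := card_sphereS_le hsimple hconn hreg hk x hi; rewrite natrM; lra.
Qed.
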